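(* There exists a block gluing $\mathbb{Z}^2$ nearest neighbor shift of finite type $Y$ for which $\lim_{n\to\infty} \left(h_{n+1}(Y)-h_n(Y)\right)$ does not exist.
   Context: An alphabet is a finite set $A$ with at least two elements. Sites $u,v\in\mathbb{Z}^d$ are adjacent if $\sum_i|u_i-v_i|=1$. A $\mathbb{Z}^d$ nearest neighbor shift of finite type (SFT) $X$ with alphabet $A$ is the set of all $x\in A^{\mathbb{Z}^d}$ in which no configuration from a given finite list $\mathcal{F}$ appears (at any location), where $\mathcal{F}$ consists of forbidden pairs of adjacent letters (the pair of letters together with a cardinal direction). $L_S(X)$ denotes the set of globally admissible configurations on $S$, i.e. restrictions to $S$ of points of $X$. The topological entropy of a $\mathbb{Z}^d$ subshift $X$ is $h^{top}(X)=\lim_{j_1,\ldots,j_d\to\infty}\frac{\ln|L_{\prod_i[1,j_i]}(X)|}{j_1\cdots j_d}$, where $[a,b]=\{a,\ldots,b\}$. A $\mathbb{Z}^d$ subshift $X$ is block gluing if there exists $R$ such that for any finite rectangular prisms $S,T\subset\mathbb{Z}^d$ satisfying $\|s-t\|_\infty>R$ for all $s\in S$, $t\in T$, and for any $u\in L_S(X)$ and $v\in L_T(X)$, there exists $x\in X$ with $x|_S=u$ and $x|_T=v$. For a $\mathbb{Z}^2$ nearest neighbor SFT $X$ and $n\ge1$, $H_n(X)$ is the set of configurations in $A^{\mathbb{Z}\times\{1,\ldots,n\}}$ containing no forbidden pair of adjacent letters for $X$. It is regarded as a $\mathbb{Z}$ nearest neighbor SFT whose alphabet is the set of $n$-high columns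 containing no forbidden pair, and $h_n(X):=h^{top}(H_n(X))$ is its topological entropy as a $\mathbb{Z}$ SFT. *)

(* Defs.v *)
From HB Require Import structures.
From mathcomp Require Import all_boot all_order all_algebra finmap.
From mathcomp Require Import all_classical all_reals all_analysis.

Set Implicit Arguments.
Unset Strict Implicit.
Unset Printing Implicit Defensive.

Import Order.TTheory GRing.Theory Num.Theory.
Import numFieldNormedType.Exports.

Local Open Scope classical_set_scope.
Local Open Scope ring_scope.

Notation site d := 'rV[int]_d.

Definition sup_norm d (u : site d) : nat := \max_(i < d) `|u 0%R i|%N.

Definition prism d (a b : site d) : {fset site d} :=
  fset_set [set u : site d | forall i, a 0 i <= u 0 i <= b 0 i].

(* [fset_set] is the empty set on infinite arguments; prisms are finite. *)
Lemma in_prism d (a b u : site d) :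
  (u \in prism a b) = [forall i, a 0 i <= u 0 i <= b 0 i].
Proof.
rewrite in_fset_set; last first.
  pose m := (\max_(i < d) `|(b 0 i - a 0 i)%R|).+1%N.
  pose f (w : {ffun 'I_d -> 'I_m}) : site d := \row_i (a 0 i + (w i : nat)%:Z).
  apply: (@sub_finite_set _ _ (f @` setT)); last exact/finite_image/finite_finset.
  move=> v /= hv; exists [ffun i : 'I_d => inord `|(v 0 i - a 0 i)%R|%N] => //.
  apply/rowP => i; rewrite mxE ffunE inordK; last first.
    rewrite ltnS (leq_trans _ (leq_bigmax i)) //.
    have /andP[h1 h2] := hv i.
    by rewrite -lez_nat !gez0_abs ?subr_ge0 ?lerB // (le_trans h1 h2).
  by have /andP[h1 _] := hv i; rewrite gez0_abs ?subr_ge0 // addrC subrK.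
apply/idP/forallP; first by rewrite inE.
by move=> h; rewrite inE.
Qed.

Section Shifts.
Variables (d : nat) (A : finType).

(* A letter pair [(i, a, b)] is forbidden at [u] when [a] sits at [u] and [b]
   at [u + e_i]; pairs in a negative direction are recorded with the letters
   exchanged. As [A] is finite, so is the list of forbidden pairs. *)
Definition forbidden_pairs := {set 'I_d * A * A}.

Definition nnSFT (F : forbidden_pairs) : set (site d -> A) :=
  [set x | forall (u : site d) (i : 'I_d),
     (i, x u, x (u + delta_mx 0 i)) \notin F].

Definition restriction (S : {fset site d}) (x : site d -> A) : {ffun S -> A} :=
  [ffun s => x (val s)].

Definition language (X : set (site d -> A)) (S : {fset site d}) :
    {set {ffun S -> A}} :=
  [set w | `[< exists2 x, X x & restriction S x = w >]]%SET.

Definition block_gluing (X : set (site d -> A)) : Prop :=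
  exists R : nat, forall a b a' b' : site d,
    (forall s t, s \in prism a b -> t \in prism a' b' ->
       (R < sup_norm (s - t)%R)%N) ->
    forall u v, u \in language X (prism a b) -> v \in language X (prism a' b') ->
      exists x, [/\ X x, restriction (prism a b) x = u
                  & restriction (prism a' b') x = v].

(* The filter of neighborhoods of j_1, ..., j_d --> oo. *)
Definition all_to_infty : set_system ('I_d -> nat) :=
  filter_from [set: nat] (fun N => [set j | forall i, (N <= j i)%N]).

(* The limit exists for every subshift, by subadditivity of the logarithm of
   the number of patterns. As [ln 0 = 0], the empty shift has entropy [0]. *)
Definition entropy (R : realType) (X : set (site d -> A)) : R :=
  lim ((fun j : 'I_d -> nat =>
          ln #|language X (prism (const_mx 1) (\row_i (j i)%:Z))|%:R
            / (\prod_i j i)%N%:R : R) @ all_to_infty).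

End Shifts.

Section Strips.
Variables (A : finType) (F : forbidden_pairs 2 A) (n : nat).

Definition horizontal : 'I_2 := ord0.
Definition vertical : 'I_2 := ord_max.

(* The rows 1, ..., n of the strip are indexed by 0, ..., n - 1. *)
Definition column_allowed (c : {ffun 'I_n -> A}) : bool :=
  [forall k : 'I_n, forall l : 'I_n,
     (l == k.+1 :> nat) ==> ((vertical, c k, c l) \notin F)].

Definition column := {c : {ffun 'I_n -> A} | column_allowed c}.

Definition strip_pairs : forbidden_pairs 1 column :=
  [set p : 'I_1 * column * column | [exists k : 'I_n,
     (horizontal, val p.1.2 k, val p.2 k) \in F]]%SET.

Definition strip : set (site 1 -> column) := nnSFT strip_pairs.

Definition strip_entropy (R : realType) : R := entropy R strip.

(* [strip] is the set of configurations on Z x {1, ..., n} without forbidden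
   pairs. *)
Lemma stripP (y : int -> 'I_n -> A) :
  (exists2 x, strip x & forall (z : int) k, val (x (const_mx z)) k = y z k) <->
  (forall z k, (horizontal, y z k, y (z + 1) k) \notin F) /\
  (forall z (k l : 'I_n), l = k.+1 :> nat -> (vertical, y z k, y z l) \notin F).
Proof.
have shiftE (z : int) : const_mx z + delta_mx 0 0 = const_mx (z + 1) :> site 1.
  by apply/rowP => i; rewrite !mxE ord1 eqxx.
split=> [[x hx xy]|[hh hv]].
  split=> z k => [|l kl].
    have := hx (const_mx z) 0; rewrite inE negb_exists => /forallP/(_ k) /=.
    by rewrite shiftE !xy.
  have /forallP/(_ k)/forallP/(_ l) := valP (x (const_mx z)).
  by rewrite kl eqxx !xy.
have ok z : column_allowed [ffun k => y z k].
  apply/forallP => k; apply/forallP => l; apply/implyP => /eqP kl.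
  by rewrite !ffunE; exact: hv.
exists (fun u : site 1 => exist column_allowed _ (ok (u 0 0))) => [u i|z k]; last by rewrite /= ffunE mxE.
rewrite inE negb_exists; apply/forallP => k /=.
by rewrite !ffunE !mxE (ord1 i) eqxx; exact: hh.
Qed.

End Strips.

(* Main.v *)
Require Import Defs.
From mathcomp Require Import all_boot all_order all_algebra finmap.
From mathcomp Require Import all_classical all_reals all_analysis.
From mathcomp Require Import zify ring lra.

(** The shift consists of rigid layers cut by expensive walls.

    The letters, up to colour, are: Bulk p with p a parity, in N colours; Edge p
    in N^2 colours; and two colourless walls, Upright and Level. Bulk and Edge
    letters alternate in parity vertically and keep their parity horizontally.
    An Upright wall can only stop, upwards or downwards, at a wall, and a Level
    wall can only stop, leftwards or rightwards, at a wall. Nothing is allowed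
    below Edge false or above Edge true, and the two horizontal neighbours of an
    Edge letter are Edge letters of the same parity.

    In the plane there are no Edge letters, since each has a neighbour on its
    forbidden side. Two points of the shift can then be juxtaposed along any
    column filled with Upright, or along any row filled with Level, whence block
    gluing ([block_gluing_walls]).

    In a strip of height h the Edge letters may occupy the extreme rows, where
    each of them multiplies the number of columns by N^2 instead of N. Having
    Edge false at the bottom, Edge true at the top and alternation in between
    forces h to be even. So for h even the layered columns without walls give
    entropy at least (h + 2) ln N, while for h odd a column must give up one of
    its two Edge letters or contain a wall. This defect costs a factor of order
    N per column, the same for all h, and it is not recovered by the freedom in
    placing the walls: the entropy is at most (h + 1) ln N + ln 5.

    The upper bounds are row-sum estimates for the transfer matrix. If f is a
    positive function on columns and the sum of f over the columns that may
    follow c is at most Lambda f(c), then the entropy is at most ln Lambda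
    ([entropy_le]). Here f(c) = 3^(number of Upright in c): the weight 3 pays for
    the choice of a new phase after an Upright wall, and where the wall appears
    it is covered by the N colours that the wall lacks. The sum over the columns following c runs over the
    vertical paths d_0, d_1, ... compatible with c, so that it is itself bounded
    by the same argument in the vertical direction ([sum_path_weights],
    [next_letter_le]). Its test function is 2 at Level and 1 elsewhere: along a
    wall-free stretch of c, the only choice is whether d has an Upright wall all
    along it, and this is decided by the letter of d just below the stretch,
    unless that letter is Level or the stretch begins at the bottom.

    With N = 6 the increments h_(n+1) - h_n are at most ln 5 for infinitely many
    n and at least 2 ln 6 - ln 5 > ln 5 for infinitely many others. *)

Import Order.TTheory GRing.Theory Num.Theory.
Import numFieldNormedType.Exports.

Local Open Scope classical_set_scope.
Local Open Scope ring_scope.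

Set Implicit Arguments.
Unset Strict Implicit.
Unset Printing Implicit Defensive.

(** * Convergence and path sums *)

Lemma all_to_infty_proper d : ProperFilter (@all_to_infty d).
Proof.
apply: filter_from_proper => [|N _]; last by exists (fun=> N) => i /=.
apply: filter_from_filter => [|N M _ _]; first by exists 0%N.
exists (maxn N M) => // j jNM; split=> i; apply: leq_trans (jNM i);
  [exact: leq_maxl | exact: leq_maxr].
Qed.
#[local] Existing Instance all_to_infty_proper.

Definition ffun_cons (T : finType) n (a : T) (f : {ffun 'I_n -> T}) :
    {ffun 'I_n.+1 -> T} :=
  [ffun i => if unlift ord0 i is Some j then f j else a].

Lemma sum_ffun_cons (T : finType) n (G : {ffun 'I_n.+1 -> T} -> nat) :
  (\sum_f G f = \sum_a \sum_f G (ffun_cons a f))%N.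
Proof.
rewrite pair_bigA /= (reindex (fun p => ffun_cons p.1 p.2)) //.
exists (fun f : {ffun 'I_n.+1 -> T} => (f ord0, [ffun j => f (lift ord0 j)])).
  move=> [a f] _ /=; rewrite ffunE unlift_none; congr (_, _).
  by apply/ffunP => j; rewrite !ffunE liftK.
move=> f _; apply/ffunP => i; rewrite ffunE.
by case: unliftP => [j ->|->]; rewrite ?ffunE.
Qed.

(** The iterated row-sum estimate for a product of nonnegative kernels. The
    kernels depend on the position, because in the vertical application each
    position of the path faces a different letter of the previous column. *)
Lemma sum_path_weights (T : finType) n (g : T -> nat)
    (W : nat -> T -> T -> nat) (phi : T -> nat) (mu : nat -> nat) :
    (forall a, (0 < phi a)%N) ->
    (forall i a, (\sum_b W i a b * phi b <= mu i * phi a)%N) ->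
  (\sum_(f : {ffun 'I_n.+1 -> T})
     g (f ord0) * \prod_(i < n) W i (f (widen_ord (leqnSn n) i)) (f (lift ord0 i))
   <= (\sum_a g a * phi a) * \prod_(i < n) mu i)%N.
Proof.
move=> phi_gt0; elim: n g W mu => [|n IHn] g W mu Wmu.
  rewrite big_ord0 muln1 sum_ffun_cons; apply: leq_sum => a _.
  rewrite (eq_bigr (fun=> g a)); last first.
    by move=> f _; rewrite big_ord0 muln1 ffunE unlift_none.
  by rewrite sum_nat_const card_ffun card_ord expn0 mul1n leq_pmulr.
rewrite sum_ffun_cons exchange_big /=.
rewrite (eq_bigr (fun f : {ffun 'I_n.+1 -> T} =>
  (\sum_a g a * W 0%N a (f ord0)) * \prod_(i < n)
     W i.+1 (f (widen_ord (leqnSn n) i)) (f (lift ord0 i)))%N); last first.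
  move=> f _; rewrite big_distrl /=; apply: eq_bigr => a _.
  rewrite big_ord_recl mulnA; congr (_ * _ * _)%N.
  - by rewrite ffunE unlift_none.
  - rewrite !ffunE /= liftK.
    suff -> : unlift ord0 (widen_ord (leqnSn n.+1) ord0) = None by [].
    by case: unliftP => // j /(congr1 val).
  apply: eq_bigr => i _; rewrite !ffunE liftK.
  suff -> : widen_ord (leqnSn n.+1) (lift ord0 i)
            = lift ord0 (widen_ord (leqnSn n) i) by rewrite liftK.
  exact/val_inj.
apply: leq_trans (IHn (fun b => \sum_a g a * W 0%N a b)%N (fun i => W i.+1)
  (fun i => mu i.+1) _) _ => [i a|]; first exact: Wmu.
rewrite big_ord_recl mulnA leq_mul2r; apply/orP; right.
under eq_bigr do rewrite big_distrl /=.
rewrite exchange_big big_distrl /=; apply: leq_sum => a _.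
rewrite -mulnA (mulnC (phi a)); apply: leq_trans (leq_mul (leqnn _) (Wmu 0%N a)).
by rewrite big_distrr /=; apply: leq_sum => b _; rewrite mulnA.
Qed.

(** * Entropy of one-dimensional shifts *)

Section Entropy1.
Variables (A : finType) (G : forbidden_pairs 1 A).

Let follows a b := (ord0, a, b) \notin G.
Let box (j : 'I_1 -> nat) : {fset site 1} := prism (const_mx 1) (\row_i (j i)%:Z).

Lemma in_box j u : (u \in box j) = (1 <= u 0 0 <= (j 0)%:Z).
Proof.
rewrite in_prism; apply/forallP/idP => [/(_ ord0)|h i]; first by rewrite !mxE.
by rewrite !mxE (ord1 i).
Qed.

(* Sites outside the box read a meaningless letter of [w]. *)
Let word n (w : {ffun 'I_n.+1 -> A}) (u : site 1) := w (inord `|(u 0 0 - 1)%R|%N).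

Lemma card_language_le (f : A -> nat) (Lambda n : nat) (j : 'I_1 -> nat) :
    (forall a, (0 < f a)%N) ->
    (forall a, (\sum_(b | follows a b) f b <= Lambda * f a)%N) -> j ord0 = n.+1 ->
  (#|language (nnSFT G) (box j)| <= (\sum_a f a) * Lambda ^ n)%N.
Proof.
move=> f_gt0 f_le jn.
pose P := [set w : {ffun 'I_n.+1 -> A} | [forall i : 'I_n,
  follows (w (widen_ord (leqnSn n) i)) (w (lift ord0 i))]]%SET.
apply: (@leq_trans #|P|).
  apply: leq_trans (leq_imset_card
    (fun w : {ffun 'I_n.+1 -> A} => restriction (box j) (word w)) P).
  apply/subset_leq_card/fintype.subsetP => v; rewrite inE => /asboolP[x Xx <-].
  apply/imsetP; exists [ffun k : 'I_n.+1 => x (const_mx (k : nat).+1%:Z)].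
    rewrite inE; apply/forallP => i; rewrite !ffunE /=.
    have := Xx (const_mx (i : nat).+1%:Z) ord0; rewrite /follows.
    suff -> : (const_mx (i : nat).+1%:Z : site 1) + delta_mx 0 ord0
              = const_mx (lift ord0 i : nat).+1%:Z by [].
    by apply/rowP => k; rewrite !mxE (ord1 k) eqxx lift0; lia.
  apply/ffunP => s; rewrite !ffunE /word ffunE.
  have := fsvalP s; rewrite in_box jn.
  rewrite -[fsval s]/(\val s); move: (\val s) => u u_in.
  have zE (z : int) : 1 <= z <= n.+1%:Z ->
      (`|(z - 1)%R|%N < n.+1)%N /\ z = `|(z - 1)%R|%N.+1%:Z by lia.
  have [u_lt uE] := zE _ u_in.
  by congr x; apply/rowP => i; rewrite mxE (ord1 i) inordK.
have := @sum_path_weights _ n (fun=> 1%N)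
  (fun _ a b => nat_of_bool (follows a b)) f (fun=> Lambda) f_gt0.
rewrite prod_nat_const card_ord => le_paths.
rewrite -(eq_bigr _ (fun a _ => mul1n (f a))).
apply: leq_trans (le_paths _) => [|_ a]; last first.
  apply: leq_trans (f_le a); rewrite [leqRHS]big_mkcond /=; apply: leq_sum => b _.
  by case: follows; rewrite ?mul1n.
rewrite -sum1_card big_mkcond /=; apply: leq_sum => w _.
rewrite inE mul1n; case: ifP => // /forallP w_path.
by rewrite big1 // => i _; rewrite w_path.
Qed.

(** Any sequence of letters of [P] is a point, so all words over [P] occur. *)
Lemma card_language_ge (P : {set A}) (n : nat) (j : 'I_1 -> nat) :
    {in P &, forall a b, follows a b} -> j ord0 = n.+1 ->
  (#|P| ^ n.+1 <= #|language (nnSFT G) (box j)|)%N.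
Proof.
move=> P_free jn.
pose D := [set w : {ffun 'I_n.+1 -> A} | [forall k, w k \in P]]%SET.
have <- : #|D| = (#|P| ^ n.+1)%N.
  rewrite -[in RHS](card_ord n.+1) -card_ffun_on /D cardsE.
  by apply: eq_card => w.
rewrite -(@card_in_imset _ _ (fun w => restriction (box j) (word w))).
  apply/subset_leq_card/fintype.subsetP => v /imsetP[w wD ->].
  rewrite inE; apply/asboolP; exists (word w) => // u i; rewrite (ord1 i).
  by move: wD; rewrite inE => /forallP wP; apply: P_free; apply: wP.
move=> w w' _ _ ww'; apply/ffunP => k.
have k_in : const_mx (k : nat).+1%:Z \in box j.
  by rewrite in_box jn !mxE; have := ltn_ord k; lia.
have := congr1 (fun v : {ffun box j -> A} => v [` k_in]%fset) ww'.
have kE : inord `|((const_mx (k : nat).+1%:Z : site 1) 0 0 - 1)%R|%N = k.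
  by apply: val_inj; rewrite /= inordK !mxE; have := ltn_ord k; lia.
by rewrite !ffunE /word kE.
Qed.

Lemma ln_card_le (R : realType) (f : A -> nat) (Lambda : nat) (j : 'I_1 -> nat) :
    (0 < Lambda)%N -> (forall a, (0 < f a)%N) ->
    (forall a, (\sum_(b | follows a b) f b <= Lambda * f a)%N) ->
    (0 < j ord0)%N ->
  ln #|language (nnSFT G) (box j)|%:R
    <= ln (\sum_a f a).+1%:R + (j ord0)%:R * ln Lambda%:R :> R.
Proof.
move=> L_gt0 f_gt0 f_le; case jn : (j ord0) => [//|n] _.
have C_gt0 : (0 < (\sum_a f a).+1%:R :> R) by rewrite ltr0n.
have L_gt0R : (0 < Lambda%:R :> R) by rewrite ltr0n.
have lnL_ge0 : (0 <= ln Lambda%:R :> R) by rewrite ln_ge0 // ler1n.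
rewrite mulr_natl -lnXn // -lnM ?posrE ?exprn_gt0 //.
have [->|L0] := posnP #|language (nnSFT G) (box j)|.
  by rewrite ln0 // ln_ge0 // -natrX -natrM ler1n muln_gt0 expn_gt0 L_gt0.
rewrite ler_ln ?posrE ?mulr_gt0 ?exprn_gt0 ?ltr0n // -natrX -natrM ler_nat.
apply: leq_trans (card_language_le f_gt0 f_le jn) _.
by rewrite leq_mul // leq_pexp2l.
Qed.

Local Notation rate R := (fun j : 'I_1 -> nat =>
  ln #|language (nnSFT G) (box j)|%:R / (\prod_i j i)%N%:R : R).

Lemma rate_near_le (R : realType) (f : A -> nat) (Lambda : nat) (e : R) :
    (0 < Lambda)%N -> (forall a, (0 < f a)%N) ->
    (forall a, (\sum_(b | follows a b) f b <= Lambda * f a)%N) -> 0 < e ->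
  \forall j \near all_to_infty (d := 1), rate R j <= ln Lambda%:R + e.
Proof.
move=> L_gt0 f_gt0 f_le e_gt0.
set C : R := ln (\sum_a f a).+1%:R.
exists (Num.truncn (C / e)).+1 => // j /(_ ord0) j_big /=.
have j_gt0 : (0 < j ord0)%N by exact: leq_trans j_big.
have jR_gt0 : 0 < (j ord0)%:R :> R by rewrite ltr0n.
rewrite big_ord1 ler_pdivrMr //.
apply: le_trans (ln_card_le _ L_gt0 f_gt0 f_le j_gt0) _.
rewrite addrC mulrDl [in leLHS]mulrC lerD2l -ler_pdivrMl // mulrC.
by apply/ltW/(lt_le_trans (truncnS_gt _)); rewrite ler_nat.
Qed.

(** The transfer matrix with row sums at most [Lambda], relative to the weight
    [f], has spectral radius at most [Lambda]. *)
Lemma entropy_le (R : realType) (f : A -> nat) (Lambda : nat) :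
    (0 < Lambda)%N -> (forall a, (0 < f a)%N) ->
    (forall a, (\sum_(b | follows a b) f b <= Lambda * f a)%N) ->
  entropy R (nnSFT G) <= ln Lambda%:R.
Proof.
move=> L_gt0 f_gt0 f_le; rewrite /entropy.
(* A divergent [lim] takes the default value 0, which obeys the bound too. *)
have [cv|ncv] := pselect (cvg (rate R @ all_to_infty (d := 1))); last first.
  by rewrite dvgP // ln_ge0 // ler1n.
apply/ler_addgt0Pr => e e_gt0; apply: limr_le => //.
exact: rate_near_le f_gt0 f_le e_gt0.
Qed.

(** The words over [P] already exhaust the growth that the row sums allow; this
    also settles the existence of the limit. *)
Lemma entropy_eq (R : realType) (f : A -> nat) (P : {set A}) :
    (0 < #|P|)%N -> {in P &, forall a b, follows a b} ->
    (forall a, (0 < f a)%N) ->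
    (forall a, (\sum_(b | follows a b) f b <= #|P| * f a)%N) ->
  entropy R (nnSFT G) = ln #|P|%:R.
Proof.
move=> P_gt0 P_free f_gt0 f_le; apply: cvg_lim => //.
apply/cvgrPdist_le => e e_gt0; near=> j.
have j_gt0 : (0 < j ord0)%N.
  by near: j; exists 1%N => // j /(_ ord0).
have jR_gt0 : 0 < (j ord0)%:R :> R by rewrite ltr0n.
have le_rate : ln #|P|%:R <= rate R j.
  rewrite /= big_ord1 ler_pdivlMr // mulrC mulr_natl -lnXn ?ltr0n // -natrX.
  have le_card : (#|P| ^ j ord0 <= #|language (nnSFT G) (box j)|)%N.
    by move: j_gt0; case jn : (j ord0) => [//|n] _; exact: card_language_ge.
  have Pj_gt0 : (0 < #|P| ^ j ord0)%N by rewrite expn_gt0 P_gt0.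
  by rewrite ler_ln ?posrE ?ltr0n ?ler_nat // (leq_trans Pj_gt0).
rewrite distrC ger0_norm ?subr_ge0 // lerBlDl.
by near: j; exact: rate_near_le f_gt0 f_le e_gt0.
Unshelve. all: by end_near. Qed.

End Entropy1.

(** * The shift *)

(** The boolean is a parity, meant as that of the height above the bottom row
    of a strip: Edge false is a bottom edge and Edge true a top edge. *)
Inductive kind := Bulk of bool | Edge of bool | Upright | Level.

Definition beside k l :=
  match k, l with
  | Bulk p, Bulk q | Edge p, Edge q => p == q
  | Edge _, _ | _, Edge _ => false
  | Bulk _, Level | Level, Bulk _ => false
  | _, _ => true
  end.

Definition below k l :=
  match k, l with
  | _, Edge false | Edge true, _ => false
  | (Bulk p | Edge p), (Bulk q | Edge q) => p != q
  | (Bulk _ | Edge _), Upright | Upright, (Bulk _ | Edge _) => false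
  | _, _ => true
  end.

Section Shift.
Variable N : nat.

Definition letter := (bool * 'I_N + bool * 'I_(N ^ 2) + bool)%type.

Definition kind_of (a : letter) : kind :=
  match a with
  | inl (inl (p, _)) => Bulk p
  | inl (inr (p, _)) => Edge p
  | inr true => Upright
  | inr false => Level
  end.

Definition walls : forbidden_pairs 2 letter :=
  [set p | ~~ (if p.1.1 == horizontal then beside (kind_of p.1.2) (kind_of p.2)
               else below (kind_of p.1.2) (kind_of p.2))]%SET.

Lemma horizontal_walls a b :
  ((horizontal, a, b) \notin walls) = beside (kind_of a) (kind_of b).
Proof. by rewrite inE /= ?eqxx negbK. Qed.

Lemma vertical_walls a b :
  ((vertical, a, b) \notin walls) = below (kind_of a) (kind_of b).
Proof. by rewrite inE /= negbK. Qed.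

Lemma sum_kind (h : kind -> nat) :
  (\sum_(a : letter) h (kind_of a) =
     N * (h (Bulk true) + h (Bulk false))
     + N ^ 2 * (h (Edge true) + h (Edge false)) + (h Upright + h Level))%N.
Proof.
have colours M (u : bool -> nat) :
    (\sum_(x : bool * 'I_M) u x.1 = M * (u true + u false))%N.
  rewrite -(pair_bigA _ (fun p _ => u p)) /= -big_bool big_distrr /=.
  by apply: eq_bigr => p _; rewrite sum_nat_const card_ord.
rewrite 2!big_sumType big_bool /= -(colours N (h \o Bulk)).
rewrite -(colours (N ^ 2)%N (h \o Edge)); congr (_ + _ + _)%N;
  by apply: eq_bigr => -[p c].
Qed.

Definition is_edge k := if k is Edge _ then true else false.

(** An Edge letter cannot have any letter on one of its vertical sides. *)
Lemma nnSFT_no_edge x u : nnSFT walls x -> ~~ is_edge (kind_of (x u)).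
Proof.
move=> Xx; have := Xx u vertical; have := Xx (u - delta_mx 0 vertical) vertical.
rewrite subrK !vertical_walls.
case: (kind_of (x u)) (kind_of (x (u - delta_mx 0 vertical)))
  (kind_of (x (u + delta_mx 0 vertical))) => [p|[]||] [q|[]||] [r|[]||] //=.
Qed.

Definition glue (i : 'I_2) (c : int) (w : bool) (x y : site 2 -> letter) (u : site 2) :=
  if u 0 i < c then x u else if u 0 i == c then inr w else y u.

(** A line of walls perpendicular to axis [i] is compatible with every letter of
    a point on either side, and with itself along the line. *)
Lemma nnSFT_glue i c x y : nnSFT walls x -> nnSFT walls y ->
  nnSFT walls (glue i c (i == horizontal) x y).
Proof.
move=> Xx Xy u k; rewrite /glue !mxE eqxx /=.
have ordP (l : 'I_2) : l = horizontal \/ l = vertical.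
  by case: l => -[|[|//]] ?; [left|right]; exact: val_inj.
set w : letter := inr _.
have w_side a : ~~ is_edge (kind_of a) ->
    ((i, a, w) \notin walls) && ((i, w, a) \notin walls).
  rewrite /w; case: (ordP i) => ->; rewrite ?horizontal_walls ?vertical_walls /=;
    by case: (kind_of a).
case: (eqVneq i k) => [<-|ik] /=; last first.
  rewrite addr0; case: ifP => _; first exact: Xx.
  case: ifP => _; last exact: Xy.
  rewrite /w; move: ik; case: (ordP i) => ->; case: (ordP k) => -> //;
    by rewrite ?horizontal_walls ?vertical_walls.
have [ui_lt|ui_gt|ui_eq] := ltgtP (u 0 i) c.
- have [uc|] := eqVneq (u 0 i + 1) c.
    by rewrite uc ltxx; case/andP: (w_side _ (nnSFT_no_edge u Xx)).
  by move=> uc; rewrite ifT; [exact: Xx | lia].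
- by rewrite ifF ?ifF; [exact: Xy | lia | lia].
rewrite ifF ?ifF; try lia.
by case/andP: (w_side _ (nnSFT_no_edge (u + delta_mx 0 i) Xy)).
Qed.

(** Rectangles at distance more than 1 leave room for a separating line. *)
Lemma block_gluing_walls : block_gluing (nnSFT walls).
Proof.
exists 1%N => a b a' b' far u v; rewrite !inE.
move=> [x Xx <-] [y Yy <-].
have [/forallP ab|] := boolP [forall i, a 0 i <= b 0 i]; last first.
  rewrite negb_forall => /existsP[i ba]; exists y; split => //.
  apply/ffunP => s; have := fsvalP s; rewrite in_prism => /forallP/(_ i) /andP[? ?].
  by case/negP: ba; lia.
have [/forallP ab'|] := boolP [forall i, a' 0 i <= b' 0 i]; last first.
  rewrite negb_forall => /existsP[i ba]; exists x; split => //.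
  apply/ffunP => s; have := fsvalP s; rewrite in_prism => /forallP/(_ i) /andP[? ?].
  by case/negP: ba; lia.
(* Otherwise the prisms come within distance 1 on both axes: clamping a corner
   of the second prism into the first, and the result back into the second,
   gives sites [s] and [t] that contradict [far]. *)
have [i gap] : exists i, (b 0 i + 1 < a' 0 i) \/ (b' 0 i + 1 < a 0 i).
  apply: contrapT => no_gap.
  pose s : site 2 := \row_i Num.max (a 0 i) (Num.min (b 0 i) (a' 0 i)).
  pose t : site 2 := \row_i Num.max (a' 0 i) (Num.min (b' 0 i) (s 0 i)).
  have := far s t; rewrite !in_prism => /(_ _ _)/wrap[||].
  - by apply/forallP => i; rewrite !mxE; have := ab i; lia.
  - by apply/forallP => i; rewrite !mxE; have := ab' i; lia.
  apply/negP; rewrite -leqNgt; apply/bigmax_leqP => i _; rewrite !mxE.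
  have := ab i; have := ab' i.
  have : ~ ((b 0 i + 1 < a' 0 i) \/ (b' 0 i + 1 < a 0 i)).
    by move=> h; apply: no_gap; exists i.
  lia.
have glued c (S T : {fset site 2}) (x1 x2 : site 2 -> letter) :
    nnSFT walls x1 -> nnSFT walls x2 ->
    (forall s, s \in S -> s 0 i < c) -> (forall t, t \in T -> c < t 0 i) ->
  exists z, [/\ nnSFT walls z, restriction S z = restriction S x1
              & restriction T z = restriction T x2].
  move=> X1 X2 Sc Tc; exists (glue i c (i == horizontal) x1 x2).
  split; first exact: nnSFT_glue.
    by apply/ffunP => s; rewrite !ffunE /glue (Sc _ (fsvalP s)).
  apply/ffunP => t; have := Tc _ (fsvalP t); rewrite !ffunE /glue => ct.
  by rewrite ltNge ltW //= gt_eqF.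
have left_of c (e f s : site 2) : f 0 i < c -> s \in prism e f -> s 0 i < c.
  by rewrite in_prism => fc /forallP/(_ i) /andP[_ sf]; exact: le_lt_trans fc.
have right_of c (e f s : site 2) : c < e 0 i -> s \in prism e f -> c < s 0 i.
  by rewrite in_prism => ce /forallP/(_ i) /andP[es _]; exact: lt_le_trans es.
case: gap => gap.
  apply: (glued (b 0 i + 1)) => // s; first by apply: left_of; rewrite ltrDl.
  exact: right_of.
have [//|//|s|s|z [Xz zT zS]] :=
  glued (b' 0 i + 1) (prism a' b') (prism a b) y x.
- by apply: left_of; rewrite ltrDl.
- exact: right_of.
by exists z.
Qed.

(** * Row sums of the transfer matrix of a strip *)

(** Three is the least integer weight that pays for an Upright wall being
    followed by either phase, by Level (room 2) or by Upright: this needs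
    2 N + 2 + 3 <= 3 N. *)
Definition test_factor k := if k is Upright then 3 else 1%N.

(** The vertical test function. Above Level there are two possibilities next to
    a Bulk letter, repeating it or starting an Upright wall; above any other
    letter at most one of them is left. *)
Definition room k := if k is Level then 2 else 1%N.

(** The factor that a letter of a column contributes to the bound on the
    weighted number of its successors. For Level, which can only be followed by
    Level or Upright, it is 2 + 3. *)
Definition growth k :=
  match k with Bulk _ | Upright => N | Edge _ => N ^ 2 | Level => 5 end%N.

(** [k] is the letter of the previous column at the current height, [l] the
    letter just below in the new column and [b] the new letter. *)
Lemma next_letter_le k l : (4 < N)%N ->
  (\sum_(b : letter) below l (kind_of b) *
       (beside k (kind_of b) * test_factor (kind_of b)) * room (kind_of b)
   <= growth k * test_factor k * room l)%N.
Proof.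
move=> N_gt4.
rewrite (sum_kind (fun x => below l x * (beside k x * test_factor x) * room x)%N).
have : (0 < N ^ 2)%N by rewrite expn_gt0; lia.
by case: k l => [[]|[]||] [[]|[]||] /=; lia.
Qed.

(** At the bottom there is no letter below to forbid an Upright wall, hence the
    factor 2. A bottom edge can only be repeated, so it does not pay for it;
    this makes the bound on the entropy of strips of even height sharp. *)
Lemma first_letter_le k : (4 < N)%N ->
  (\sum_(b : letter)
       beside k (kind_of b) * test_factor (kind_of b) * room (kind_of b)
   <= (if k is Edge false then 1 else 2) * growth k * test_factor k)%N.
Proof.
move=> N_gt4.
rewrite (sum_kind (fun x => beside k x * test_factor x * room x)%N).
by case: k => [[]|[]||] /=; lia.
Qed.

Section Columns.
Variable n : nat.
Local Notation column := (column walls n.+1).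
Local Notation follows c d := ((ord0, c, d) \notin strip_pairs walls n.+1).
Implicit Types c d : column.

Let kd c i := kind_of (val c i).

Lemma followsE c d : follows c d = [forall k, beside (kd c k) (kd d k)].
Proof.
rewrite inE negb_exists; apply: eq_forallb => k /=.
by rewrite horizontal_walls.
Qed.

Lemma column_allowedP (g : {ffun 'I_n.+1 -> letter}) :
  reflect (forall i : 'I_n, below (kind_of (g (widen_ord (leqnSn n) i)))
                                  (kind_of (g (lift ord0 i))))
          (column_allowed walls g).
Proof.
apply: (iffP forallP) => [g_ok i|g_ok k].
  have /forallP/(_ (lift ord0 i)) := g_ok (widen_ord (leqnSn n) i).
  by rewrite lift0 eqxx vertical_walls.
apply/forallP => l; apply/implyP => /eqP kl; rewrite vertical_walls.
have k_lt : (k < n)%N by have := ltn_ord l; lia.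
have := g_ok (Ordinal k_lt); congr (below (kind_of (g _)) (kind_of (g _)));
  by apply: val_inj => //=; rewrite lift0 kl.
Qed.

Lemma below_next c i : below (kd c (widen_ord (leqnSn n) i)) (kd c (lift ord0 i)).
Proof. exact: (column_allowedP _ (valP c)). Qed.

Definition test c := (\prod_i test_factor (kd c i))%N.

Lemma test_gt0 c : (0 < test c)%N.
Proof. by rewrite prodn_gt0 // => i; case: kd. Qed.

Definition bottom_factor c := if kd c ord0 is Edge false then 1%N else 2.

Lemma followers_le c : (4 < N)%N ->
  (\sum_(d | follows c d) test d
     <= bottom_factor c * (\prod_i growth (kd c i)) * test c)%N.
Proof.
move=> N_gt4.
pose h i (b : letter) := (beside (kd c i) (kind_of b) * test_factor (kind_of b))%N.
pose G (g : {ffun 'I_n.+1 -> letter}) := (\prod_i h i (g i))%N.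
have -> : (\sum_(d | follows c d) test d = \sum_(d : column) G (val d))%N.
  rewrite big_mkcond; apply: eq_bigr => d _; rewrite followsE /G big_split /=.
  case: forallP => [cd|/forallP]; first by rewrite big1 ?mul1n // => i _; rewrite cd.
  by rewrite negb_forall => /existsP[i /negbTE i0]; rewrite (bigD1 i) //= i0 !mul0n.
rewrite -(big_sub _ G).
have inord_lift (i : 'I_n) : inord i.+1 = lift ord0 i.
  by apply: val_inj; rewrite /= inordK // ltnS.
pose W i (a b : letter) := (below (kind_of a) (kind_of b) * h (inord i.+1) b)%N.
apply: leq_trans (_ : \sum_(g : {ffun 'I_n.+1 -> letter})
  h ord0 (g ord0) * \prod_(i < n) W i (g (widen_ord (leqnSn n) i)) (g (lift ord0 i))
  <= _)%N.
  rewrite big_mkcond /=; apply: leq_sum => g _; case: ifP => // /column_allowedP g_ok.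
  rewrite /G big_ord_recl leq_mul //; apply: leq_prod => i _.
  by rewrite /W g_ok mul1n inord_lift.
apply: leq_trans (@sum_path_weights _ n (h ord0) W (fun b => room (kind_of b))
   (fun i => growth (kd c (inord i.+1)) * test_factor (kd c (inord i.+1)))%N
   _ _) _.
- by move=> b; case: (kind_of b).
- by move=> i a; exact: next_letter_le.
apply: leq_trans (leq_mul (first_letter_le _ N_gt4) (leqnn _)) _.
have shift (F : 'I_n.+1 -> nat) :
    (\prod_(i < n) F (inord i.+1) = \prod_(i < n) F (lift ord0 i))%N.
  by apply: eq_bigr => i _; rewrite -inord_lift.
rewrite big_split /= (shift (fun i => growth (kd c i))).
rewrite (shift (fun i => test_factor (kd c i))) /test !big_ord_recl.
by rewrite /bottom_factor; apply: eq_leq; ring.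
Qed.

(** At height h = n + 1 this reads 5 N^(h + 1) for h odd, N^(h + 2) for h even. *)
Definition column_growth := (if odd n.+1 then 5 * N ^ n.+2 else N ^ n.+3)%N.

Lemma edge_bottom c i : kd c i = Edge false -> i = ord0.
Proof.
case: (unliftP ord0 i) => [j ->|//]; have := below_next c j => + ce.
by rewrite ce; case: (kd c _) => [?|[]||].
Qed.

Lemma edge_top c i : kd c i = Edge true -> i = ord_max.
Proof.
case: (unliftP ord_max i) => [j ->|//]; have := below_next c j => + ce.
rewrite (_ : widen_ord _ j = lift ord_max j) ?ce; first by case: (kd c _) => [?|[]||].
by apply: val_inj; rewrite /= /bump leqNgt ltn_ord.
Qed.

Lemma prod_at (j : 'I_n.+1) (b : bool) :
  (\prod_(i < n.+1) N ^ ((i == j) && b) = N ^ b)%N.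
Proof.
rewrite (bigD1 j) //= eqxx big1 ?muln1 // => i /negbTE ->.
by rewrite expn0.
Qed.

Lemma growth_edges c i : (4 < N)%N ->
  (growth (kd c i) <= N * (N ^ ((i == ord0) && is_edge (kd c ord0))
                           * N ^ ((i == ord_max) && is_edge (kd c ord_max))))%N.
Proof.
move=> N_gt4; have N_gt0 : (0 < N)%N by exact: leq_trans N_gt4.
set u := (N ^ _ * N ^ _)%N.
have u_gt0 : (0 < u)%N by rewrite muln_gt0 !expn_gt0 N_gt0.
case ci : (kd c i) => [p|p||] /=; rewrite ?leq_pmulr //; last first.
  by apply: leq_trans N_gt4 _; rewrite leq_pmulr.
have N_le : (N <= u)%N.
  rewrite /u; case: p ci => ci.
    have -> : (i == ord_max) && is_edge (kd c ord_max) by rewrite -(edge_top ci) eqxx ci.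
    by rewrite leq_pmull // expn_gt0 N_gt0.
  have -> : (i == ord0) && is_edge (kd c ord0) by rewrite -(edge_bottom ci) eqxx ci.
  by rewrite leq_pmulr // expn_gt0 N_gt0.
by rewrite -mulnn leq_mul.
Qed.

(** Climbing from a bottom edge, the parities alternate until the first wall,
    and that wall is Level because it sits on a letter that is not a wall. *)
Lemma odd_Level c :
  kd c ord0 = Edge false -> kd c ord_max = Edge true -> odd n.+1 ->
  exists i, kd c i = Level.
Proof.
move=> c_bot c_top n_odd; apply: contrapT => no_level.
suff inv k : (k <= n)%N ->
    kd c (inord k) = Bulk (odd k) \/ kd c (inord k) = Edge (odd k).
  have := inv n (leqnn n); rewrite (_ : inord n = ord_max); last first.
    by apply: val_inj; rewrite /= inordK.
  by rewrite c_top => -[//|[]]; move: n_odd => /= /negbTE ->.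
elim: k => [_|k IHk k_lt].
  by rewrite (_ : inord 0 = ord0) //; [right | apply: val_inj; rewrite /= inordK].
have := below_next c (Ordinal k_lt); have := IHk (ltnW k_lt).
have -> : widen_ord (leqnSn n) (Ordinal k_lt) = inord k.
  by apply: val_inj; rewrite /= inordK // ltnS ltnW.
have -> : lift ord0 (Ordinal k_lt) = inord k.+1.
  by apply: val_inj; rewrite /= inordK.
have : kd c (inord k.+1) <> Level by move=> lev; apply: no_level; exists (inord k.+1).
case: (kd c (inord k.+1)) => [[]|[]||] // _ [] -> /=;
  by case: (odd k) => //= _; auto.
Qed.

(** Only the two extreme letters can be Edge, and each then contributes an
    additional factor N; a Level wall contributes 5 in place of N. *)
Lemma prod_growth_le c (b := is_edge (kd c ord0)) (t := is_edge (kd c ord_max)) :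
    (4 < N)%N ->
  (\prod_i growth (kd c i) <= N ^ (n.+1 + b + t))%N /\
  forall i, kd c i = Level -> (\prod_i growth (kd c i) <= 5 * N ^ (n + b + t))%N.
Proof.
move=> N_gt4; have N_gt0 : (0 < N)%N by exact: leq_trans N_gt4.
pose F (i : 'I_n.+1) := (N * (N ^ ((i == ord0) && b) * N ^ ((i == ord_max) && t)))%N.
have prodF : (\prod_i F i = N ^ (n.+1 + b + t))%N.
  by rewrite !big_split /= !prod_at prod_nat_const card_ord -!expnD addnA.
have le_F i : (growth (kd c i) <= F i)%N by exact: growth_edges.
split=> [|i ci]; first by rewrite -prodF; apply: leq_prod.
rewrite -(leq_pmul2l N_gt0) mulnCA -expnS -!addSn -prodF.
rewrite (bigD1 i) //= [in leqRHS](bigD1 i) //= ci /= mulnCA leq_mul //.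
rewrite leq_mul //; last exact: leq_prod.
by rewrite leq_pmulr // muln_gt0 !expn_gt0 N_gt0.
Qed.

(** In odd height, two Edge letters come with a Level wall; with at most one
    Edge letter, the factor 2 is absorbed by the missing factor N, or by the 5
    of the bound. *)
Lemma column_growth_le c : (4 < N)%N -> (0 < n)%N ->
  (bottom_factor c * (\prod_i growth (kd c i)) <= column_growth)%N.
Proof.
move=> N_gt4 n_gt0; have N_gt0 : (0 < N)%N by exact: leq_trans N_gt4.
have [] := prod_growth_le c N_gt4; set P := (\prod_i _)%N => P_le P_Level.
have pow_gt0 m : (0 < N ^ m)%N by rewrite expn_gt0 N_gt0.
have bottom_le2 : (bottom_factor c <= 2)%N by rewrite /bottom_factor; case: kd => [|[]||].
have [/andP[c_bot c_top]|not_both] :=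
  boolP (is_edge (kd c ord0) && is_edge (kd c ord_max)); last first.
  have {}P_le : (P <= N ^ n.+2)%N.
    apply: leq_trans P_le _; rewrite leq_pexp2l //.
    by case: is_edge not_both; case: is_edge => //=; lia.
  apply: leq_trans (leq_mul bottom_le2 P_le) _; rewrite /column_growth.
  case: ifP => _; first by rewrite leq_mul.
  by rewrite [leqRHS]expnS leq_mul // (leq_trans _ N_gt4).
have {P_le}P_le : (P <= N ^ n.+3)%N by move: P_le; rewrite c_bot c_top !addn1.
have {}P_Level i : kd c i = Level -> (P <= 5 * N ^ n.+2)%N.
  by move=> /P_Level; rewrite c_bot c_top !addn1.
case c0 : (kd c ord0) (c_bot) => [|[]||] // _.
  by have /(congr1 val) /= n0 := edge_top c0; rewrite -n0 in n_gt0.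
case cn : (kd c ord_max) (c_top) => [|[]||] // _; last first.
  by have /(congr1 val) /= n0 := edge_bottom cn; rewrite n0 in n_gt0.
rewrite /bottom_factor c0 mul1n /column_growth; case: ifP => [n_odd|_ //].
have [i ci] := odd_Level c0 cn n_odd.
exact: P_Level ci.
Qed.

Lemma row_sum_le c : (4 < N)%N -> (0 < n)%N ->
  (\sum_(d | follows c d) test d <= column_growth * test c)%N.
Proof.
move=> N_gt4 n_gt0; apply: leq_trans (followers_le c N_gt4) _.
by rewrite leq_mul // column_growth_le.
Qed.

Lemma column_growth_gt0 : (4 < N)%N -> (0 < column_growth)%N.
Proof.
move=> N_gt4; have pow_gt0 m : (0 < N ^ m)%N by rewrite expn_gt0; lia.
by rewrite /column_growth; case: odd => //; rewrite muln_gt0 pow_gt0.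
Qed.

(** * Layered columns *)

Definition layered i k :=
  match k with
  | Edge p => if p then i == n else i == 0%N
  | Bulk p => (p == odd i) && (0 < i < n)%N
  | _ => false
  end.

Definition layered_columns : {set column} :=
  [set c : column | [forall i : 'I_n.+1, layered i (kind_of (val c i))]]%SET.

Lemma layered_allowed (g : {ffun 'I_n.+1 -> letter}) : odd n ->
  (forall i : 'I_n.+1, layered i (kind_of (g i))) -> column_allowed walls g.
Proof.
move=> n_odd g_lay; apply/column_allowedP => i.
have := g_lay (lift ord0 i); have := g_lay (widen_ord (leqnSn n) i).
rewrite lift0 /=; have := ltn_ord i; move: (nat_of_ord i) => k.
case: (kind_of (g (widen_ord _ _))) => [p|[]||] //= k_lt;
  case: (kind_of (g (lift ord0 i))) => [[]|[]||] //=; lia.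
Qed.

Lemma card_layered : odd n -> #|layered_columns| = column_growth.
Proof.
move=> n_odd; rewrite /column_growth /= n_odd /=.
pose F (i : 'I_n.+1) (b : letter) : nat := layered i (kind_of b).
transitivity (\sum_(g : {ffun 'I_n.+1 -> letter}) \prod_(i < n.+1) F i (g i))%N.
  rewrite -sum1_card big_mkcond /=.
  pose G (g : {ffun 'I_n.+1 -> letter}) :=
    nat_of_bool [forall i : 'I_n.+1, layered i (kind_of (g i))].
  rewrite (eq_bigr (fun c => G (val c))); last by move=> c _; rewrite inE /G; case: ifP.
  rewrite -(big_sub (@column_allowed _ walls n.+1) G) [LHS]big_mkcond /=.
  apply: eq_bigr => g _; rewrite /G.
  case: (boolP [forall i : 'I_n.+1, layered i (kind_of (g i))]).
    move=> /forallP g_lay; rewrite ifT; last exact: layered_allowed.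
    by rewrite big1 // => i _; rewrite /F g_lay.
  rewrite negb_forall if_same => /existsP[i /negbTE i0].
  by rewrite (bigD1 i) //= /F i0.
rewrite -bigA_distr_bigA /=.
have sumF (i : 'I_n.+1) : (\sum_(b : letter) F i b
    = if (i == ord0) || (i == ord_max) then N ^ 2 else N)%N.
  rewrite (sum_kind (fun k => nat_of_bool (layered i k))) /= -!val_eqE /=.
  move: (nat_of_ord i) (ltn_ord i) => k k_le.
  have n_neq0 : (0 == n)%N = false by case: n n_odd.
  have [->|k_neq0] := eqVneq k 0%N.
    by rewrite /= n_neq0 !addn0 muln0 !add0n muln1.
  have [->|k_neqn] := eqVneq k n.
    by rewrite orbT ltnn !andbF /= !addn0 muln0 add0n muln1.
  have -> : (0 < k < n)%N by lia.
  by case: (odd k) => /=; rewrite !addn0 muln0 muln1 addn0.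
under eq_bigr do rewrite sumF.
case: n n_odd => [//|m] _ in F sumF *.
rewrite big_ord_recl big_ord_recr /= -!val_eqE /= eqxx.
rewrite (eq_bigr (fun=> N)) => [|i _].
  by rewrite prod_nat_const card_ord -!expnD; congr (_ ^ _)%N; lia.
by rewrite ifF // -val_eqE /= /bump /=; apply/negbTE; have := ltn_ord i; lia.
Qed.

Lemma layered_free : odd n ->
  {in layered_columns &, forall c d, follows c d}.
Proof.
move=> n_odd c d; rewrite followsE !inE => /forallP c_lay /forallP d_lay.
apply/forallP => i; rewrite /kd.
have := c_lay i; have := d_lay i; move: (nat_of_ord i) => k.
case: (kind_of (val c i)) => [[]|[]||]; case: (kind_of (val d i)) => [[]|[]||] //=; lia.
Qed.

Lemma strip_entropy_le (R : realType) : (4 < N)%N -> (0 < n)%N ->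
  strip_entropy walls n.+1 R <= ln (column_growth)%:R.
Proof.
move=> N_gt4 n_gt0; apply: (@entropy_le _ _ R test).
- exact: column_growth_gt0.
- exact: test_gt0.
- by move=> c; exact: row_sum_le.
Qed.

Lemma strip_entropy_eq (R : realType) : (4 < N)%N -> odd n ->
  strip_entropy walls n.+1 R = ln (column_growth)%:R.
Proof.
move=> N_gt4 n_odd; rewrite -card_layered //.
have n_gt0 : (0 < n)%N by case: n n_odd.
apply: (@entropy_eq _ _ R test).
- by rewrite card_layered // column_growth_gt0.
- exact: layered_free.
- exact: test_gt0.
- by move=> c; rewrite card_layered //; exact: row_sum_le.
Qed.

End Columns.
End Shift.

Theorem theorem16 (R : realType) :
  exists (A : finType) (F : forbidden_pairs 2 A),
    [/\ (1 < #|A|)%N,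
        block_gluing (nnSFT F)
      & ~ exists l : R,
          (fun n : nat => strip_entropy F n.+1 R - strip_entropy F n R)
            @ \oo --> l].
Proof.
exists (letter 6), (walls 6); split.
- by rewrite !card_sum !card_prod card_bool !card_ord.
- exact: block_gluing_walls.
case=> l /cvgrPdist_lt cv.
pose a : R := ln 6; pose b : R := ln 5.
have b_lt : b < a by rewrite ltr_ln ?posrE // ltr_nat.
have even_h k : strip_entropy (walls 6) k.*2.+2 R = a *+ k.*2.+4.
  rewrite strip_entropy_eq //= ?odd_double // /column_growth /= odd_double /=.
  by rewrite natrX lnXn.
have odd_h k : strip_entropy (walls 6) k.*2.+3 R <= b + a *+ k.*2.+4.
  apply: le_trans (strip_entropy_le _ _ _) _ => //.
  by rewrite /column_growth /= odd_double /= natrM natrX lnM ?posrE ?exprn_gt0 // lnXn.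
(* The limit would be within (a - b) / 2 of increments <= b and >= 2 a - b. *)
have [|m _ near_l] := cv ((a - b) / 2); first by rewrite divr_gt0 // subr_gt0.
have := near_l m.*2.+2; have := near_l m.*2.+3; rewrite /=.
have -> : (m <= m.*2.+2)%N by lia.
have -> : (m <= m.*2.+3)%N by lia.
move=> /(_ isT) + /(_ isT).
have := even_h m; have := odd_h m; have := even_h m.+1.
rewrite doubleS => h1 h2 h3; rewrite !ltr_distlC h1 h3 => /andP[? ?] /andP[? ?].
rewrite !mulrSr in h1 h3 *; lra.
Qed.
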